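(* Let $H(\cdot,D)$ be a pseudo-differential operator with symbol $H(q,p)$ such that $-H(\cdot,D)$ generates a Feller semigroup $(T_t)_{t\ge0}$ on $C_\infty(\mathbb{R}^d)$, $T_t\varphi(q)=\int_{\mathbb{R}^d}\varphi(y)\,p_t(q,dy)$, where $p_t(q,dy)$ is the transition probability of the underlying Feller process. Let $a:\mathbb{R}^d\to[c,1/c]$, $c>0$, be a continuous function, and let $(\widetilde T_t)_{t\ge0}$ be the strongly continuous semigroup on $C_\infty(\mathbb{R}^d)$ generated by the pseudo-differential operator $-\widetilde H(\cdot,D)=-a(\cdot)H(\cdot,D)$ with symbol $-\widetilde H(q,p)=-a(q)H(q,p)$. For $t\ge0$ define $$\widetilde F(t)\varphi(q)=(T_{a(q)t}\varphi)(q)=\int_{\mathbb{R}^d}\varphi(y)\,p_{a(q)t}(q,dy),\qquad \varphi\in C_\infty(\mathbb{R}^d),\ q\in\mathbb{R}^d.$$ Then the family $(\widetilde F(t))_{t\ge0}$ is Chernoff equivalent to the semigroup $(\widetilde T_t)_{t\ge0}$ and, hence, the Lagrangian Feynman formula $$\widetilde T_t\varphi(q_0)=\lim_{n\to\infty}\int_{\mathbb{R}^d}\cdots\int_{\mathbb{R}^d}\varphi(q_n)\,p_{a(q_0)t/n}(q_0,dq_1)\,p_{a(q_1)t/n}(q_1,dq_2)\cdots p_{a(q_{n-1})t/n}(q_{n-1},dq_n)$$ holds in the strong operator topology on $C_\infty(\mathbb{R}^d)$ (i.e. $\widetilde T_t\varphi=\lim_{n\to\infty}[\widetilde F(t/n)]^n\varphi$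 in supremum norm for every $\varphi\in C_\infty(\mathbb{R}^d)$), locally uniformly with respect to $t\ge0$.
   Context: $C_\infty(\mathbb{R}^d)$ is the Banach space of continuous functions on $\mathbb{R}^d$ vanishing at infinity, with the supremum norm. A Feller semigroup is a strongly continuous positivity preserving contraction semigroup on $C_\infty(\mathbb{R}^d)$. The statement that $-H(\cdot,D)$ generates $(T_t)_{t\ge0}$ means: the generator of $(T_t)_{t\ge0}$, denoted $(-H(\cdot,D),D(H(\cdot,D)))$, has $C_c^\infty(\mathbb{R}^d)$ in its domain and acts there as $-H(q,D)\varphi(q)=-(2\pi)^{-d/2}\int_{\mathbb{R}^d}e^{ip\cdot q}H(q,p)\widehat\varphi(p)\,dp$, where $\widehat\varphi(p)=(2\pi)^{-d/2}\int e^{-ip\cdot q}\varphi(q)\,dq$. The operator $-\widetilde H(\cdot,D)$ is the product $-a(\cdot)H(\cdot,D)$ with the same domain $D(H(\cdot,D))$; it is a known result (Dorroh) that it generates a strongly continuous semigroup on $C_\infty(\mathbb{R}^d)$. Chernoff equivalence: let $X$ be a Banach space and $(T_t)_{t\ge0}$ a strongly continuous semigroup on $X$ with generator $(A,D(A))$. A family $(F(t))_{t\ge0}$ of bounded linear operators on $X$ is Chernoff equivalent to $(T_t)_{t\ge0}$ if $t\mapsto F(t)$ is strongly continuous, $F(0)=\mathrm{Id}$, $\|F(t)\|\le e^{\alpha t}$ for some $\alpha\in[0,\infty)$ and all $t\ge0$, and there is a linear subspace $D$ of $D(F'(0))$ such that the restriction of $F'(0)$ to $D$ is closable with closure $(A,D(A))$.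 Here $F'(0)g=\lim_{t\searrow0}\frac{F(t)g-F(0)g}{t}$, with $D(F'(0))$ the set of all $g\in X$ for which the limit exists. *)

(* Defs.v *)
From HB Require Import structures.
From mathcomp Require Import all_boot all_order all_algebra.
From mathcomp Require Import all_classical all_reals all_analysis measurable_realfun.
From mathcomp Require Import complex ring.

Set Implicit Arguments.
Unset Strict Implicit.
Unset Printing Implicit Defensive.

Import Order.TTheory GRing.Theory Num.Theory.
Import numFieldNormedType.Exports.

Local Open Scope classical_set_scope.
Local Open Scope ring_scope.

Section C0_pred.
Context {R : realType} {d : nat}.

Definition vanishing_at_infinity (f : 'rV[R]_d -> R) : Prop :=
  forall e : R, 0 < e -> exists M : R, forall x, M < `|x| -> `|f x| < e.

Definition C0_pred : {pred 'rV[R]_d -> R} :=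
  [pred f | `[< continuous f /\ vanishing_at_infinity f >]].

Lemma C0_submod_closed : submod_closed C0_pred.
Proof.
split.
  apply/asboolP; split; first exact: (@cst_continuous _ _ (0 : R)).
  move=> e e0; exists 0 => x _.
  by have -> : (0 : 'rV[R]_d -> R) x = 0 by []; rewrite normr0.
move=> k f g /asboolP[cf vf] /asboolP[cg vg]; apply/asboolP; split.
  move=> x.
  suff : (fun y => k * f y + g y) @ x --> k * f x + g x by [].
  exact: cvgD (cvgM (cvg_cst k) (cf x)) (cg x).
move=> e e0.
have k0 : 0 < `|k| + 1 by rewrite ltr_wpDl.
have e1 : 0 < e / 2 / (`|k| + 1) by rewrite !divr_gt0.
have e2 : 0 < e / 2 by rewrite divr_gt0.
have [M1 M1P] := vf _ e1; have [M2 M2P] := vg _ e2.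
exists (Num.max M1 M2) => x; rewrite gt_max => /andP[/M1P h1 /M2P h2].
have -> : (k *: f + g) x = k * f x + g x by [].
rewrite (le_lt_trans (ler_normD _ _))// [ltRHS]splitr ler_ltD//.
rewrite normrM; move: h1; rewrite ltr_pdivlMr// => /ltW; apply: le_trans.
by rewrite mulrC ler_wpM2l// lerDl.
Qed.

HB.instance Definition _ :=
  GRing.isSubmodClosed.Build R _ C0_pred C0_submod_closed.

End C0_pred.

(* C_oo(R^d), real-valued; made below into a completeNormedModType R for the
   supremum norm C0_norm. *)
Record C0 (R : realType) (d : nat) :=
  MkC0 { C0_fun :> 'rV[R]_d -> R ; C0_funP : C0_fun \in C0_pred }.

Section C0_lmod.
Variables (R : realType) (d : nat).
HB.instance Definition _ := [isSub for @C0_fun R d].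
HB.instance Definition _ := [Choice of C0 R d by <:].
HB.instance Definition _ := [SubChoice_isSubLmodule of C0 R d by <:].
End C0_lmod.

Section C0_norm.
Variables (R : realType) (d : nat).
Implicit Types f g : C0 R d.

Lemma C0_continuous f : continuous f.
Proof. by have /asboolP[] := C0_funP f. Qed.

Lemma C0_vanishing f : vanishing_at_infinity f.
Proof. by have /asboolP[] := C0_funP f. Qed.

Lemma C0E f g : f =1 g -> f = g.
Proof. by move=> fg; apply/val_inj/funext. Qed.

Lemma C0D f g x : (f + g) x = f x + g x. Proof. by []. Qed.
Lemma C0Z k f x : (k *: f) x = k * f x. Proof. by []. Qed.
Lemma C0B f g x : (f - g) x = f x - g x. Proof. by []. Qed.

Definition C0_norm f : R := sup [set `|f x| | x in [set: 'rV[R]_d]].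

Lemma C0_has_sup f : has_sup [set `|f x| | x in [set: 'rV[R]_d]].
Proof.
split; first by exists `|f 0|, 0.
have [M MP] := C0_vanishing f ltr01.
have [|B [_ BP]] := @compact_bounded R R^o
    (f @` [set x : 'rV[R]_d | `|x| <= M]) _.
  apply: continuous_compact.
    by apply: continuous_subspaceT; exact: C0_continuous.
  apply: bounded_closed_compact.
    exists M; split; first exact: num_real.
    by move=> y My x /= xM; rewrite (le_trans xM)// ltW.
  by apply: (@closed_comp _ _ _ [set y : R | y <= M]); [
    move=> x _; exact: norm_continuous|exact: closed_le].
exists (Num.max 1 (B + 1)) => _ [x _ <-]; rewrite le_max.
have [xM|/MP/ltW->//] := leP `|x| M.
by apply/orP; right; apply: (BP (B + 1)); [rewrite ltrDl|exists x].
Qed.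

Lemma C0_norm_ge f x : `|f x| <= C0_norm f.
Proof. by apply: (ub_le_sup (C0_has_sup f).2); exists x. Qed.

Lemma C0_norm_le f (M : R) : (forall x, `|f x| <= M) -> C0_norm f <= M.
Proof.
by move=> fM; apply: ge_sup; [exact: (C0_has_sup f).1|move=> _ [x _ <-]].
Qed.

Let normD f g : C0_norm (f + g) <= C0_norm f + C0_norm g.
Proof.
apply: C0_norm_le => x; rewrite C0D (le_trans (ler_normD _ _))//.
by rewrite lerD// C0_norm_ge.
Qed.

Let normZ k f : C0_norm (k *: f) = `|k| * C0_norm f.
Proof.
have le l h : C0_norm (l *: h) <= `|l| * C0_norm h.
  by apply: C0_norm_le => x; rewrite C0Z normrM ler_wpM2l// C0_norm_ge.
apply/eqP; rewrite eq_le le /=; have [->|k0] := eqVneq k 0.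
  by rewrite normr0 mul0r (le_trans _ (C0_norm_ge _ 0)).
rewrite -ler_pdivlMl ?normr_gt0// -normfV.
by apply: le_trans (le _ _); rewrite scalerA mulVf// scale1r.
Qed.

Let norm0_eq0 f : C0_norm f = 0 -> f = 0.
Proof.
move=> f0; apply: C0E => x; apply/eqP; rewrite -normr_le0.
by rewrite -f0 C0_norm_ge.
Qed.

HB.instance Definition _ :=
  @Lmodule_isNormed.Build R (C0 R d) C0_norm normD normZ norm0_eq0.

Lemma C0_normE f : `|f| = C0_norm f. Proof. by []. Qed.

Lemma C0_complete (F : set_system (C0 R d)) :
  ProperFilter F -> cauchy F -> cvg F.
Proof.
move=> FF /cauchyP Fc.
have Fx (x : 'rV[R]_d) : cvg ((fun f : C0 R d => f x : R) @ F).
  apply: cauchy_cvg; apply: cauchy_exP => e e0.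
  have [f0 Ff0] := Fc _ e0; exists (f0 x).
  suff : F [set f : C0 R d | ball (f0 x : R) e (f x : R)] by [].
  apply: filterS Ff0 => f; rewrite -ball_normE => ff0.
  rewrite /= -ball_normE; exact: le_lt_trans (C0_norm_ge (f0 - f) x) ff0.
pose g (x : 'rV[R]_d) : R := lim ((fun f : C0 R d => f x : R) @ F).
have gP e (f0 : C0 R d) : F (ball f0 e) -> forall x, `|f0 x - g x| <= e.
  move=> Ff0 x.
  have h : (fun f : C0 R d => `|f0 x - f x|) @ F --> `|f0 x - g x|.
    by apply: cvg_norm; apply: cvgB; [exact: cvg_cst|exact: Fx].
  rewrite -(cvg_lim _ h)//; apply: limr_le.
    by apply/cvg_ex; eexists; exact: h.
  apply: filterS Ff0 => f; rewrite -ball_normE => /ltW; apply: le_trans.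
  exact: (C0_norm_ge (f0 - f) x).
have gC0 : g \in C0_pred.
  apply/asboolP; split => [x|e e0].
    apply/(@cvgrPdist_lt _ _ _ (nbhs x)) => e e0; have e3 : 0 < e / 3 by rewrite divr_gt0.
    have [f0 /gP f0g] := Fc _ e3.
    have := @C0_continuous f0 x; move/(@cvgrPdist_lt _ _ _ (nbhs x)) => /(_ _ e3).
    apply: filterS => y f0xy.
    rewrite (_ : g x - g y = - (f0 x - g x) + ((f0 x - f0 y) + (f0 y - g y))).
      rewrite (le_lt_trans (ler_normD _ _))// normrN.
      rewrite (_ : e = e / 3 + (e / 3 + e / 3)); last first.
        by field.
      rewrite ler_ltD// (le_lt_trans (ler_normD _ _))//.
      by rewrite ltr_leD.
    by ring.
  have e2 : 0 < e / 2 by rewrite divr_gt0.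
  have [f0 /gP f0g] := Fc _ e2.
  have [M MP] := C0_vanishing f0 e2; exists M => x /MP f0x.
  rewrite (_ : g x = f0 x - (f0 x - g x)); last by rewrite opprB addrC subrK.
  by rewrite (le_lt_trans (ler_normB _ _))// [ltRHS]splitr ltr_leD.
apply/cvg_ex; exists (MkC0 gC0); apply/cvgrPdist_le => e e0.
have e2 : 0 < e / 2 by rewrite divr_gt0.
have [f0 Ff0] := Fc _ e2; have f0g := gP _ _ Ff0.
apply: filterS Ff0 => f; rewrite -ball_normE /= => /ltW f0f.
apply: C0_norm_le => x; rewrite C0B /=.
rewrite (_ : g x - f x = - (f0 x - g x) + (f0 x - f x)); last first.
  by rewrite opprB addrA subrK.
rewrite (le_trans (ler_normD _ _))// normrN [leRHS]splitr lerD//.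
by rewrite -C0B (le_trans (C0_norm_ge _ _)).
Qed.

HB.instance Definition _ := Uniform_isComplete.Build (C0 R d) C0_complete.

End C0_norm.

(* 'M[R]_(m, n), hence R^d = 'rV[R]_d, carries its Borel sigma-algebra. *)
HB.instance Definition _ (R : realType) (m n : nat) :=
  Measurable.copy 'M[R]_(m, n) (g_sigma_algebraType (@open 'M[R]_(m, n))).

Section lebesgue_row.
Context {R : realType}.

Lemma measurable_fun_row d (S : measurableType d) n (f : S -> 'rV[R]_n) :
  (forall i, measurable_fun [set: S] (fun s => f s 0 i : R)) ->
  measurable_fun [set: S] f.
Proof.
move=> mf; apply: (@measurability _ _ _ _ _ _ (@open 'rV[R]_n)) => //.
move=> _ [U oU <-]; rewrite setTI.
pose B (ck : 'rV[rat]_n * nat) : set 'rV[R]_n :=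
  [set v | forall i, `|ratr (ck.1 0 i) - v 0 i| < ck.2.+1%:R^-1].
rewrite (_ : f @^-1` U = \bigcup_(ck in [set: 'rV[rat]_n * nat])
    [set s | B ck (f s) /\ B ck `<=` U]); last first.
  apply/seteqP; split=> [s Us|s [ck _ [Bs]]]; last exact.
  have /nbhs_ballP[e /= e0 eU] : nbhs (f s) U by exact: open_nbhs_nbhs.
  have [k ke] : exists k, k.+1%:R^-1 < e / 2.
    have e20 : 0 < e / 2 by rewrite divr_gt0.
    have [k _ kP] := near_infty_natSinv_lt (PosNum e20).
    by exists k; apply: (kP k) => /=.
  have /choice[q qP] : forall i, exists q : rat,
      `|ratr q - f s 0 i| < k.+1%:R^-1.
    move=> i.
    have [|q] := @rat_in_itvoo R (f s 0 i - k.+1%:R^-1) (f s 0 i + k.+1%:R^-1).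
      by rewrite ltrBlDr -addrA ltrDl addr_gt0// invr_gt0.
    by rewrite in_itv /= -ltr_distl => h; exists q.
  exists (\row_i q i, k) => //; split=> [i|v vB]; first by rewrite /= mxE.
  apply: eU; split=> // i j; rewrite ord1.
  rewrite -ball_normE /= (_ : f s 0 j - v 0 j =
    - (ratr (q j) - f s 0 j) + (ratr (q j) - v 0 j)); last by ring.
  rewrite (le_lt_trans (ler_normD _ _))// normrN [ltRHS]splitr ltrD//.
    exact: lt_trans (qP j) ke.
  by have := vB j; rewrite /= mxE => /lt_trans; apply.
apply: countable_bigcupT_measurable => // ck.
have [BU|BU] := pselect (B ck `<=` U); last first.
  by rewrite [X in measurable X](_ : _ = set0)// -subset0 => s [].
rewrite [X in measurable X](_ : _ = \bigcap_(i in [set: 'I_n])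
    ((fun s => f s 0 i : R) @^-1`
      [set x : R | `|ratr (ck.1 0 i) - x| < ck.2.+1%:R^-1])).
  apply: fin_bigcap_measurable => // i _; rewrite -[X in measurable X]setTI.
  apply: mf => //; apply: open_measurable.
  rewrite (_ : [set x | _] = ball (ratr (ck.1 0 i) : R) ck.2.+1%:R^-1).
    by apply: ball_open; rewrite invr_gt0.
  by rewrite -ball_normE.
by apply/seteqP; split=> [s [Bs _] i _|s Bs]; [exact: Bs|split=> // i; exact: Bs].
Qed.

Lemma measurable_coord n (i : 'I_n) :
  measurable_fun [set: 'rV[R]_n] (fun v : 'rV[R]_n => v 0 i : R).
Proof.
apply: (measurability _ (RGenOpens.measurableE R)).
move=> _ [_ [x [y ->]] <-]; rewrite setTI; apply: sub_sigma_algebra.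
by apply: open_comp; [move=> v _; exact: coord_continuous|exact: interval_open].
Qed.

Definition rcons_row n (vx : 'rV[R]_n * measurableTypeR R) : 'rV[R]_n.+1 :=
  \row_i (if unlift ord_max i is Some j then vx.1 0 j else vx.2).

Lemma measurable_rcons_row n : measurable_fun setT (@rcons_row n).
Proof.
apply: measurable_fun_row => i; case: (unliftP ord_max i) => [j|] ij.
  rewrite (_ : (fun _ => _) = (fun v : 'rV[R]_n => v 0 j : R) \o fst).
    by apply: measurableT_comp; [exact: measurable_coord|exact: measurable_fst].
  by apply/funext => vx; rewrite mxE ij liftK.
rewrite (_ : (fun _ => _) = snd); first exact: measurable_snd.
by apply/funext => vx; rewrite mxE ij unlift_none.
Qed.

(* The pushforward of mu \x lebesgue_measure under rcons_row: [pushforward] is a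
   measure only given the measurability of the map, so its instance is applied
   by name. *)
Definition lebesgue_row_step n (mu : {measure set 'rV[R]_n -> \bar R}) :
    {measure set 'rV[R]_n.+1 -> \bar R} :=
  measure_function_pushforward__canonical__measure_function_Measure
    (mu \x @lebesgue_measure R)%E (@measurable_rcons_row n).

Lemma lebesgue_row_stepE n (mu : {measure set 'rV[R]_n -> \bar R}) A :
  lebesgue_row_step mu A = (mu \x @lebesgue_measure R)%E (@rcons_row n @^-1` A).
Proof. by []. Qed.

(* The Lebesgue measure on R^n, as an iterated product measure. *)
Fixpoint lebesgue_row n : {measure set 'rV[R]_n -> \bar R} :=
  if n is n'.+1 then lebesgue_row_step (lebesgue_row n') else \d_(0 : 'rV[R]_0).

End lebesgue_row.

Section pseudo_differential.
Context {R : realType} {d : nat}.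
Local Open Scope complex_scope.
Implicit Types (f : 'rV[R]_d -> R[i]) (phi : 'rV[R]_d -> R) (p q : 'rV[R]_d).

Definition dotr p q : R := \sum_i p 0 i * q 0 i.

Definition expi (theta : R) : R[i] := cos theta +i* sin theta.

Definition cintegrable f : Prop :=
  (lebesgue_row d).-integrable setT (EFin \o (fun x => complex.Re (f x))) /\
  (lebesgue_row d).-integrable setT (EFin \o (fun x => complex.Im (f x))).

Definition cintegral f : R[i] :=
  (\int[lebesgue_row d]_x complex.Re (f x)) +i*
  (\int[lebesgue_row d]_x complex.Im (f x)).

Definition fourier_const : R[i] := ((2 * pi) `^ (- (d%:R / 2)))%:C.

Definition fourier phi p : R[i] :=
  fourier_const * cintegral (fun q => expi (- dotr p q) * (phi q)%:C).

Definition pdo_integrand (H : 'rV[R]_d -> 'rV[R]_d -> R[i]) phi q : _ -> R[i] :=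
  fun p => expi (dotr p q) * H q p * fourier phi p.

Definition pdo (H : 'rV[R]_d -> 'rV[R]_d -> R[i]) phi q : R[i] :=
  fourier_const * cintegral (pdo_integrand H phi q).

Fixpoint Ck (k : nat) phi : Prop :=
  continuous phi /\
  if k is k'.+1 then
    forall i : 'I_d, (forall x, derivable phi x (delta_mx 0 i)) /\
                     Ck k' (fun x => 'D_(delta_mx 0 i) phi x)
  else True.

Definition compactly_supported_smooth phi : Prop :=
  (forall k, Ck k phi) /\ compact (closure [set x | phi x != 0]).

End pseudo_differential.

Section semigroups.
Context {R : realType}.

Definition bounded_linear (X : normedModType R) (A : X -> X) : Prop :=
  linear A /\ exists M : R, forall x, `|A x| <= M * `|x|.

Definition strongly_continuous (X : normedModType R) (F : R -> X -> X) : Prop :=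
  forall x, {within `[0, +oo[, continuous (fun t => F t x)}.

(* Families indexed by t >= 0 are functions on R; their values at t < 0 are
   irrelevant. *)
Definition strongly_continuous_semigroup (X : normedModType R)
    (T : R -> X -> X) : Prop :=
  [/\ forall t : R, 0 <= t -> bounded_linear (T t),
      forall x, T 0 x = x,
      forall s t : R, 0 <= s -> 0 <= t ->
        forall x, T (s + t) x = T s (T t x) &
      strongly_continuous T].

(* Unbounded operators are represented by their graphs. *)
Definition derivative_at0 (X : normedModType R) (F : R -> X -> X) :
    set (X * X) :=
  [set xy : X * X | t^-1 *: (F t xy.1 - F 0 xy.1) @[t --> (0 : R)^'+] --> xy.2].

Definition generator (X : normedModType R) (T : R -> X -> X) : set (X * X) :=
  [set xy : X * X | t^-1 *: (T t xy.1 - xy.1) @[t --> (0 : R)^'+] --> xy.2].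

Definition domain (X : normedModType R) (A : set (X * X)) : set X :=
  [set x | exists y, A (x, y)].

Definition restriction (X : normedModType R) (A : set (X * X)) (D : set X) :
    set (X * X) := [set xy : X * X | A xy /\ D xy.1].

Definition closable (X : normedModType R) (A : set (X * X)) : Prop :=
  forall x y z : X, closure A (x, y) -> closure A (x, z) -> y = z.

Definition linear_subspace (X : normedModType R) (D : set X) : Prop :=
  D 0 /\ forall (k : R) x y, D x -> D y -> D (k *: x + y).

Definition chernoff_equivalent (X : completeNormedModType R)
    (F T : R -> X -> X) : Prop :=
  [/\ forall t : R, 0 <= t -> bounded_linear (F t),
      strongly_continuous F,
      forall x, F 0 x = x,
      exists2 alpha : R, 0 <= alpha &
        forall t : R, 0 <= t -> forall x, `|F t x| <= expR (alpha * t) * `|x| &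
      exists D : set X,
        [/\ linear_subspace D, D `<=` domain (derivative_at0 F),
            closable (restriction (derivative_at0 F) D) &
            closure (restriction (derivative_at0 F) D) = generator T]].

End semigroups.

Section feller.
Context {R : realType} {d : nat}.
Implicit Types (T : R -> C0 R d -> C0 R d) (a : 'rV[R]_d -> R).

Definition feller_semigroup T : Prop :=
  [/\ strongly_continuous_semigroup T,
      forall (t : R) (phi : C0 R d), 0 <= t ->
        (forall q, 0 <= phi q) -> forall q, 0 <= T t phi q &
      forall (t : R) (phi : C0 R d), 0 <= t -> `|T t phi| <= `|phi|].

Definition neg_pdo_generates (H : 'rV[R]_d -> 'rV[R]_d -> R[i]) T : Prop :=
  forall phi : C0 R d, compactly_supported_smooth phi ->
    exists psi : C0 R d, generator T (phi, psi) /\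
      forall q, cintegrable (pdo_integrand H phi q) /\
                ((psi q)%:C)%C = - pdo H phi q.

(* The product a A, with the domain of A. *)
Definition multiply_operator a (A : set (C0 R d * C0 R d)) :
    set (C0 R d * C0 R d) :=
  [set xy : C0 R d * C0 R d |
    exists2 y : C0 R d, A (xy.1, y) & forall q, xy.2 q = a q * y q].

(* The n-fold iterated integral of phi q_n against
   p_(a q_0 s)(q_0, dq_1) ... p_(a q_(n-1) s)(q_(n-1), dq_n). *)
Fixpoint feynman_integral (p : R -> R.-spker 'rV[R]_d ~> 'rV[R]_d) a (s : R)
    (phi : 'rV[R]_d -> R) (n : nat) (q0 : 'rV[R]_d) : R :=
  if n is n'.+1 then
    \int[p (a q0 * s) q0]_q1 feynman_integral p a s phi n' q1
  else phi q0.

End feller.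

(* Main.v *)
(** The family F(t) phi (q) = (T_(a(q)t) phi)(q) consists of contractions of C_oo,
and pointwise in q it is T run for the time a(q)t, so that
|T_h x - x - h A x| <= h sup_(r <= h) |T_r A x - A x| yields F'(0) = a A on D(A).
The same estimate, and the compactness of the orbit of a A x under Ttilde over
[0, tau], make (F(h) - Ttilde_h) Ttilde_s x = o(h) uniformly in s <= tau for x in
D(A). Telescoping F(t/n)^n - Ttilde_t then costs n o(t/n), because F is
contractive: this proves the convergence on D(A), hence that Ttilde is
contractive on D(A), and both extend to C_oo because D(A) is dense.
Neither the generator estimate (a mean value inequality for right derivatives)
nor the density of D(A) (limits of averages (1/N) sum_(k < N) T_(kh/N) x) uses
vector-valued integration. *)

Require Import Defs.
From mathcomp Require Import all_boot all_order all_algebra.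
From mathcomp Require Import all_classical all_reals all_analysis complex.
From mathcomp Require Import ring lra.

Set Implicit Arguments.
Unset Strict Implicit.
Unset Printing Implicit Defensive.

Import Order.TTheory GRing.Theory Num.Theory.
Import numFieldNormedType.Exports.

Local Open Scope classical_set_scope.
Local Open Scope ring_scope.

(** * Right-hand limits and a mean value inequality on the half-line *)

Section half_line.
Context {R : realType} {X : normedModType R}.
Implicit Types (w G : R -> X) (x y : X).

Lemma continuous_half_lineP w :
  {within `[0, +oo[, continuous w} <->
  forall s e : R, 0 <= s -> 0 < e ->
    exists2 r : R, 0 < r & forall t : R, 0 <= t -> `|t - s| < r -> `|w t - w s| < e.
Proof.
split=> [/subspace_continuousP cw s e s0 e0|cw].
  have /cw/cvgrPdist_lt/(_ _ e0) : [set` `[0, +oo[] s by rewrite /= in_itv /= s0.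
  rewrite nearE /within /= => /nbhs_ballP[r /= r0 rP]; exists r => // t t0 tsr.
  rewrite distrC; apply: rP; last by rewrite in_itv /= t0.
  by rewrite -ball_normE /= distrC.
apply/subspace_continuousP => s; rewrite /= in_itv /= andbT => s0.
apply/cvgrPdist_lt => e /(cw _ _ s0)[r r0 rP].
rewrite nearE /within /=; apply/nbhs_ballP; exists r => //= t.
by rewrite -ball_normE in_itv /= andbT distrC => tr t0; rewrite distrC; exact: rP.
Qed.

Lemma cvg_quotient0P G y :
  t^-1 *: G t @[t --> (0 : R)^'+] --> y <->
  forall e : R, 0 < e -> exists2 r : R, 0 < r &
    forall t : R, 0 < t -> t <= r -> `|G t - t *: y| <= e * t.
Proof.
have eqn (t : R) : 0 < t -> forall e : R, (`|y - t^-1 *: G t| <= e) = (`|G t - t *: y| <= e * t).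
  move=> t0 e; rewrite -ler_pdivrMr// -[X in _ / X]gtr0_norm// -normfV mulrC -normrZ.
  by rewrite scalerBr scalerA mulVf ?gt_eqF// scale1r distrC.
split=> [/cvgrPdist_le Gy e e0|Gy].
  have [r /= r0 rP] := Gy _ e0; exists (r / 2); first by rewrite divr_gt0.
  move=> t t0 tr; rewrite -eqn//; apply: rP => //=.
  by rewrite sub0r normrN gtr0_norm//; lra.
apply/cvgrPdist_le => /= e /Gy[r r0 rP]; exists r => //= t.
rewrite /ball_ /= sub0r normrN => /[swap] t0; rewrite gtr0_norm// => /ltW tr.
by rewrite eqn// rP.
Qed.

(** Continuity argument with slope [K + e]: the set of times satisfying the bound contains its
    supremum, and if that were below [h], the derivative bound there would extend the set beyond
    it. *)
Lemma right_mean_value w (K h : R) : {within `[0, +oo[, continuous w} -> 0 <= h ->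
  (forall s e : R, 0 <= s < h -> 0 < e -> exists2 r : R, 0 < r &
     forall t : R, 0 < t -> t <= r -> `|w (s + t) - w s| <= (K + e) * t) ->
  `|w h - w 0| <= K * h.
Proof.
move=> /continuous_half_lineP cw h0 dw; apply/ler_addgt0Pr => e' e'0.
have h1 : 0 < h + 1 by lra.
pose e := e' / (h + 1); have e0 : 0 < e by rewrite divr_gt0.
suff : `|w h - w 0| <= (K + e) * h.
  move=> /le_trans; apply; rewrite mulrDl lerD2l /e mulrAC ler_pdivrMr//.
  by rewrite ler_wpM2l// ?ltW//; lra.
pose S := [set s : R | 0 <= s <= h /\ `|w s - w 0| <= (K + e) * s].
have S0 : S 0 by split; [rewrite lexx|rewrite subrr normr0 mulr0].
have Sub : ubound S h by move=> s [/andP[]].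
have hsS : has_sup S by split; [exists 0|exists h].
set s := sup S.
have s0 : 0 <= s by exact: (ub_le_sup hsS.2).
have sh : s <= h by apply: ge_sup => //; exists 0.
have Ss : S s.
  split; first by rewrite s0.
  apply/ler_addgt0Pr => n n0.
  have n1 : 0 < n / 2 by rewrite divr_gt0.
  (* No sign is assumed for [K], so the absolute value is needed to move the bound from [t] up to
     [s]. *)
  pose C := `|K + e| + 1; have C0 : 0 < C by rewrite ltr_wpDl.
  have [r r0 rP] := cw s (n / 2) s0 n1.
  have r'0 : 0 < Num.min r (n / 2 / C) by rewrite lt_min r0 divr_gt0.
  have [t St] := sup_adherent r'0 hsS.
  rewrite -/s => st; have ts : t <= s by exact: (ub_le_sup hsS.2).
  case: St => /andP[t0 th] tP.
  have sr : s - t < Num.min r (n / 2 / C) by lra.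
  move: sr; rewrite lt_min ltr_pdivlMr// => /andP[sr1 sr2].
  have := rP t t0; rewrite distrC ger0_norm ?subr_ge0// => /(_ sr1) wts.
  rewrite (_ : w s - w 0 = - (w t - w s) + (w t - w 0)); last first.
    by rewrite opprB addrA subrK.
  rewrite (le_trans (ler_normD _ _))// normrN.
  have : (K + e) * t <= (K + e) * s + C * (s - t).
    have : - (K + e) * (s - t) <= C * (s - t).
      rewrite ler_wpM2r ?subr_ge0// /C (le_trans (ler_norm _))// normrN; lra.
    lra.
  lra.
move: sh; rewrite le_eqVlt => /orP[/eqP <-|sh]; first by case: Ss.
have [|//|r r0 rP] := dw s e; first by rewrite s0 sh.
(* A step allowed by the derivative bound at [s] and staying within [h] gives an element of [S]
   above its supremum. *)
pose t := Num.min r (h - s).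
have t0 : 0 < t by rewrite lt_min r0 subr_gt0.
have tr : t <= r by rewrite ge_min lexx.
have th : t <= h - s by rewrite ge_min lexx orbT.
have : S (s + t).
  split; first by apply/andP; split; lra.
  rewrite (_ : w (s + t) - w 0 = (w (s + t) - w s) + (w s - w 0)); last first.
    by rewrite addrA subrK.
  rewrite (le_trans (ler_normD _ _))// mulrDr addrC lerD//; first by case: Ss.
  exact: rP.
by move=> /(ub_le_sup hsS.2); rewrite -/s; lra.
Qed.

End half_line.

(** * Orbits and the generator *)

Section semigroup.
Context {R : realType} {X : normedModType R}.
Variable S : R -> X -> X.
Hypothesis semS : strongly_continuous_semigroup S.
Implicit Types (x y z : X).

Lemma semigroupD (t : R) x y : 0 <= t -> S t (x + y) = S t x + S t y.
Proof.
case: semS => bl _ _ _ /bl[lS _].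
by rewrite -[x in LHS]scale1r lS scale1r.
Qed.

Lemma semigroupB (t : R) x y : 0 <= t -> S t (x - y) = S t x - S t y.
Proof.
case: semS => bl _ _ _ /bl[lS _].
by rewrite [x - y]addrC -scaleN1r lS scaleN1r addrC.
Qed.

Lemma semigroupZ (t k : R) x : 0 <= t -> S t (k *: x) = k *: S t x.
Proof.
move=> t0; have [lS _] : bounded_linear (S t) by case: semS => + _ _ _; apply.
have S0 : S t 0 = 0 by rewrite -[in LHS](subrr x) semigroupB// subrr.
by move: (lS k x 0); rewrite S0 !addr0.
Qed.

(** [S s] commutes with [S t] and is bounded, so it may be applied to the difference quotient of
    [x]. *)
Lemma generator_orbit x y (s : R) : 0 <= s ->
  generator S (x, y) -> generator S (S s x, S s y).
Proof.
move=> s0 /cvg_quotient0P /= gxy; apply/cvg_quotient0P => /= e e0.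
have [bl S0 SD cS] := semS; have [_ [M MP]] := bl _ s0.
have M1 : 0 < `|M| + 1 by rewrite ltr_wpDl.
have [r r0 rP] := gxy (e / (`|M| + 1)) (divr_gt0 e0 M1).
exists r => // t t0 tr; have t0' := ltW t0.
rewrite -SD// [t + s]addrC SD// -semigroupZ// -!semigroupB//.
rewrite (le_trans (MP _))// (le_trans (ler_wpM2r _ (ler_norm _)))//.
have := rP t t0 tr; rewrite mulrAC ler_pdivlMr// mulrC; apply: le_trans.
by rewrite ler_wpM2r// lerDl.
Qed.

(** The curve [S r x - r *: y] has right derivative [S r z - y], so the mean value inequality
    applies to it. *)
Lemma generator_estimate x z y (K h : R) : 0 <= h -> generator S (x, z) ->
  (forall r : R, 0 <= r <= h -> `|S r z - y| <= K) ->
  `|S h x - x - h *: y| <= K * h.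
Proof.
move=> h0 gxz zK; have [bl S0 SD cS] := semS.
have := @right_mean_value R X (fun r => S r x - r *: y) K h.
rewrite scale0r subr0 S0 addrAC; apply => //.
  apply: within_continuousB; first exact: cS.
  apply: continuous_subspaceT => t.
  by apply: cvgZr_tmp; exact: cvg_id.
move=> s e /andP[s0 sh] e0.
have := generator_orbit s0 gxz => /cvg_quotient0P/(_ _ e0)[r r0 rP].
exists r => // t t0 tr.
rewrite /= [s + t]addrC (SD _ _ (ltW t0) s0) scalerDl.
rewrite [X in `|X|](_ : _ =
    (S t (S s x) - S s x - t *: S s z) + t *: (S s z - y)).
  rewrite (le_trans (ler_normD _ _))// mulrDl addrC lerD//; last exact: rP.
  by rewrite normrZ gtr0_norm// mulrC ler_wpM2r ?(ltW t0)// zK// s0 (ltW sh).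
by rewrite scalerBr addrA subrK opprB opprD !addrA subrK addrAC.
Qed.

End semigroup.

(** * Contraction semigroups: the generator is closed and densely defined *)

Section contraction_semigroup.
Context {R : realType} {X : normedModType R}.
Variable S : R -> X -> X.
Hypothesis semS : strongly_continuous_semigroup S.
Hypothesis contrS : forall (t : R) x, 0 <= t -> `|S t x| <= `|x|.
Implicit Types (x y z w : X).

Lemma semigroup_right_continuous0 x (e : R) : 0 < e ->
  exists2 r : R, 0 < r & forall t, 0 <= t -> t <= r -> `|S t x - x| <= e.
Proof.
have [_ S0 _ /(_ x)/continuous_half_lineP cS] := semS.
move=> /(cS 0 _ (lexx _))[r r0 rP]; exists (r / 2); first by rewrite divr_gt0.
move=> t t0 tr; move: (rP t t0); rewrite subr0 ger0_norm// S0.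
by move=> rP'; apply/ltW/rP'; lra.
Qed.

(** Telescoping: each step adds the one-step error, transported by a contraction, and [dt] times the
    displacement of [z]. The vector [y] need not lie in the domain of the generator. *)
Lemma discrete_estimate y z (dt e1 e2 : R) (m : nat) : 0 < dt ->
  `|S dt y - y - dt *: z| <= e1 * dt ->
  (forall t, 0 <= t -> t <= m%:R * dt -> `|S t z - z| <= e2) ->
  `|S (m%:R * dt) y - y - (m%:R * dt) *: z| <= (e1 + e2) * (m%:R * dt).
Proof.
have [_ S0 SD _] := semS.
move=> dt0 yz; elim: m => [_|m IH ze].
  by rewrite !mul0r S0 scale0r !subrr normr0 mulr0.
have mdt0 : 0 <= m%:R * dt by rewrite mulr_ge0// ltW.
have mSE : m.+1%:R * dt = m%:R * dt + dt by rewrite -natr1 mulrDl mul1r.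
rewrite mSE in ze *.
rewrite (SD _ _ mdt0 (ltW dt0)) scalerDl.
rewrite [X in `|X|](_ : _ = (S (m%:R * dt) y - y - (m%:R * dt) *: z) +
  (S (m%:R * dt) (S dt y - y - dt *: z) + dt *: (S (m%:R * dt) z - z))).
  rewrite (le_trans (ler_normD _ _))// mulrDr lerD//.
    by apply: IH => t t0 tm; apply: ze => //; rewrite (le_trans tm)// lerDl ltW.
  rewrite (le_trans (ler_normD _ _))// mulrDl lerD//.
    by rewrite (le_trans (contrS _ _)).
  rewrite normrZ gtr0_norm// mulrC ler_wpM2r ?(ltW dt0)//.
  by apply: ze => //; rewrite lerDl ltW.
rewrite !(semigroupB semS)// (semigroupZ semS)// scalerBr !opprD !addrA subrK.
congr (_ - _); rewrite [RHS]addrC !addrA addNr add0r.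
by rewrite [RHS]addrC addrA.
Qed.

(** Approximate difference quotients at arbitrarily small steps suffice: [discrete_estimate]
    propagates them to the multiples of [dt], and contractivity controls the remainder. Both
    closedness and density rest on this criterion. *)
Lemma generator_limit w z :
  (forall e : R, 0 < e -> exists dt y,
     [/\ 0 < dt, dt <= e, `|y - w| <= e & `|S dt y - y - dt *: z| <= e * dt]) ->
  generator S (w, z).
Proof.
have [_ S0 SD _] := semS.
move=> appr; apply/cvg_quotient0P => /= e e0.
have [r r0 rP] := semigroup_right_continuous0 z e0.
exists r => // t t0 tr; apply/ler_addgt0Pr => n n0.
have n20 : 0 < n / 2 by rewrite divr_gt0.
have [r' r'0 r'P] := semigroup_right_continuous0 w n20.
(* The final sum contains [y - w] four times, the remainder [(t - s) *: z] and the slope error over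
   time [t]; together these cost at most [k * C]. *)
pose C := 4 + `|z| + t.
have C0 : 0 < C by rewrite /C; have := normr_ge0 z; lra.
pose k := Num.min r' (n / 2 / C).
have k0 : 0 < k by rewrite lt_min r'0 divr_gt0.
have kr' : k <= r' by rewrite ge_min lexx.
have kC : k * C <= n / 2 by rewrite -ler_pdivlMr// ge_min lexx orbT.
have [dt [y [dt0 dtk yw yz]]] := appr k k0.
have /truncn_itv : 0 <= t / dt by rewrite divr_ge0 ?ltW.
set m := Num.trunc _; rewrite ler_pdivlMr// ltr_pdivrMr// => /andP[mt tm].
set s := m%:R * dt in mt *.
have s0 : 0 <= s by rewrite mulr_ge0// ltW.
have q0 : 0 <= t - s by rewrite subr_ge0.
have qk : t - s < dt by move: tm; rewrite -natr1 mulrDl mul1r -/s; lra.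
have h1 : `|S s y - y - s *: z| <= (k + e) * s.
  by apply: discrete_estimate => // u u0 us; apply: rP => //; rewrite (le_trans us)// (le_trans mt).
have h2 : `|S t y - S s y| <= 2 * k + n / 2.
  have -> : S t y = S s (S (t - s) y) by rewrite -SD// addrC subrK.
  rewrite -(semigroupB semS)// (le_trans (contrS _ _))//.
  rewrite [X in `|X|](_ : _ = S (t - s) (y - w) + (S (t - s) w - w) + (w - y)); last first.
    by rewrite (semigroupB semS)// !addrA !subrK.
  rewrite (le_trans (ler_normD _ _))// (distrC w y).
  have := ler_normD (S (t - s) (y - w)) (S (t - s) w - w).
  have := contrS (y - w) q0.
  have := r'P _ q0 (ltW (lt_le_trans qk (le_trans dtk kr'))).
  lra.
rewrite [X in `|X|](_ : _ = S t (w - y) + (S t y - S s y) +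
    (S s y - y - s *: z) + (y - w) - (t - s) *: z); last first.
  rewrite (semigroupB semS) ?(ltW t0)// scalerBl opprB !addrA.
  rewrite !subrK; congr (_ - _).
  by rewrite [RHS]addrAC [_ - _ + y]addrAC !subrK.
have := contrS (w - y) (ltW t0); rewrite distrC => h3.
have h4 : `|(t - s) *: z| <= k * `|z|.
  by rewrite normrZ ger0_norm// ler_wpM2r// (le_trans (ltW qk)).
have h5 : (k + e) * s <= (k + e) * t by rewrite ler_wpM2l// addr_ge0 ?ltW.
apply: (le_trans (ler_normB _ _)).
have := ler_normD (S t (w - y) + (S t y - S s y) + (S s y - y - s *: z)) (y - w).
have := ler_normD (S t (w - y) + (S t y - S s y)) (S s y - y - s *: z).
have := ler_normD (S t (w - y)) (S t y - S s y).
rewrite /C in kC.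
lra.
Qed.

(** In [generator_limit], half of the tolerance goes to the quotient of a nearby pair of the
    generator, half to the distance between the second components. *)
Lemma generator_closed : closure (generator S) = generator S.
Proof.
apply/seteqP; split; last exact: subset_closure.
move=> [w z] cl; apply: generator_limit => e e0.
have e20 : 0 < e / 2 by rewrite divr_gt0.
have [[x y] [/cvg_quotient0P gxy]] := cl _ (nbhsx_ballx (w, z) (e / 2) e20).
case; rewrite -!ball_normE /= => wx zy.
have [r r0 /= rP] := gxy _ e20.
exists (Num.min r e), x; split.
- by rewrite lt_min r0.
- by rewrite ge_min lexx orbT.
- by rewrite distrC; lra.
set dt := Num.min r e.
have dt0 : 0 < dt by rewrite lt_min r0.
have dtr : dt <= r by rewrite ge_min lexx.
rewrite [X in `|X|](_ : _ = (S dt x - x - dt *: y) + dt *: (y - z)); last first.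
  by rewrite scalerBr addrA subrK.
rewrite (le_trans (ler_normD _ _))// [X in X * _]splitr mulrDl lerD ?rP//.
by rewrite normrZ gtr0_norm// mulrC ler_wpM2r ?(ltW dt0)// distrC ltW.
Qed.

(** For [dt = h / N] this is a left Riemann sum for the mean of [S r x] over [[0, h]]. *)
Definition orbit_average (dt : R) (N : nat) x : X :=
  N%:R^-1 *: \sum_(0 <= k < N) S (k%:R * dt) x.

Lemma semigroup_sum (t : R) (N : nat) (F : nat -> X) : 0 <= t ->
  S t (\sum_(0 <= k < N) F k) = \sum_(0 <= k < N) S t (F k).
Proof.
move=> t0; elim: N => [|N IH].
  by rewrite !big_nil -[X in S _ X](subrr (0 : X)) (semigroupB semS)// subrr.
by rewrite !big_nat_recr //= -IH (semigroupD semS).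
Qed.

Lemma orbit_average_dist dt N x y (K : R) : (0 < N)%N ->
  (forall k, (k < N)%N -> `|S (k%:R * dt) x - y| <= K) ->
  `|orbit_average dt N x - y| <= K.
Proof.
move=> N0 xK; have N0' : 0 < N%:R :> R by rewrite ltr0n.
rewrite /orbit_average.
have -> : y = N%:R^-1 *: \sum_(0 <= k < N) y.
  by rewrite sumr_const_nat subn0 -[y *+ N]scaler_nat scalerA mulVf ?scale1r ?gt_eqF.
rewrite -scalerBr -sumrB normrZ normfV gtr0_norm// ler_pdivrMl//.
rewrite (le_trans (ler_norm_sum _ _ _))//.
have -> : N%:R * K = \sum_(0 <= k < N) K by rewrite sumr_const_nat subn0 mulr_natl.
by rewrite big_nat [leRHS]big_nat ler_sum// => k /andP[_ kN]; exact: xK.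
Qed.

(** Grouped into blocks of [M] terms, the fine average is the coarse one with [x] replaced by
    [orbit_average dt M x]; contractivity bounds the effect of this replacement. *)
Lemma orbit_average_mul dt N M x : 0 <= dt -> (0 < N)%N -> (0 < M)%N ->
  `|orbit_average dt (N * M) x - orbit_average (M%:R * dt) N x| <=
  `|orbit_average dt M x - x|.
Proof.
have [_ _ SD _] := semS.
move=> dt0 N0 M0.
have -> : orbit_average dt (N * M) x =
    N%:R^-1 *: \sum_(0 <= k < N) S (k%:R * (M%:R * dt)) (orbit_average dt M x).
  rewrite /orbit_average natrM invfM -scalerA; congr (_ *: _).
  rewrite big_nat_mul scaler_sumr; apply: eq_bigr => k _.
  have k0 : 0 <= k%:R * (M%:R * dt) by rewrite !mulr_ge0.
  rewrite (semigroupZ semS)// semigroup_sum//; congr (_ *: _).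
  rewrite -{1}[(k * M)%N]add0n big_addn mulSn addnK; apply: eq_bigr => j _.
  by rewrite -SD ?mulr_ge0// natrD natrM mulrDl addrC mulrA.
have N0' : 0 < N%:R :> R by rewrite ltr0n.
rewrite /orbit_average -scalerBr -sumrB normrZ normfV gtr0_norm// ler_pdivrMl//.
rewrite (le_trans (ler_norm_sum _ _ _))//.
set K := `|_|; have -> : N%:R * K = \sum_(0 <= k < N) K by rewrite sumr_const_nat subn0 mulr_natl.
rewrite ler_sum// => k _; rewrite -(semigroupB semS) ?contrS//.
all: by rewrite !mulr_ge0.
Qed.

(** Telescoping. Divided by [dt], the right-hand side depends only on [N%:R * dt], hence not on the
    partition of a fixed interval. *)
Lemma orbit_average_step dt N x : 0 <= dt ->
  S dt (orbit_average dt N x) - orbit_average dt N x =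
  N%:R^-1 *: (S (N%:R * dt) x - x).
Proof.
have [_ S0 SD _] := semS.
move=> dt0; rewrite (semigroupZ semS)// semigroup_sum// -scalerBr -sumrB.
congr (_ *: _); transitivity (\sum_(0 <= k < N)
    (S (k.+1%:R * dt) x - S (k%:R * dt) x)).
  apply: eq_bigr => k _; rewrite -SD ?mulr_ge0//.
  by rewrite -natr1 mulrDl mul1r [_ + dt]addrC.
by rewrite telescope_sumr// mul0r S0.
Qed.

End contraction_semigroup.

(** The averages over [[0, h]] form a Cauchy sequence, and their quotients at step [h / n.+1%:R] all
    equal [h^-1 *: (S h x - x)], so [generator_limit] puts their limit in the domain. The choice of
    [h] keeps them within [e] of [x]. *)
Lemma generator_dense (R : realType) (X : completeNormedModType R)
    (S : R -> X -> X) :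
  strongly_continuous_semigroup S ->
  (forall (t : R) x, 0 <= t -> `|S t x| <= `|x|) ->
  forall x (e : R), 0 < e ->
  exists w z, generator S (w, z) /\ `|x - w| <= e.
Proof.
move=> semS contrS x e e0.
have [h h0 hP] := semigroup_right_continuous0 semS x e0.
pose W n := orbit_average S (h / n.+1%:R) n.+1 x.
have step n : 0 <= h / n.+1%:R by rewrite divr_ge0// ltW.
(* Refining the partition moves the average no further than the orbit moves within one coarse
   step. *)
have W_mul n m (K : R) : (forall t, 0 <= t -> t <= h / n.+1%:R -> `|S t x - x| <= K) ->
    `|orbit_average S (h / (n.+1 * m.+1)%:R) (n.+1 * m.+1) x - W n| <= K.
  move=> xK.
  have := @orbit_average_mul _ _ _ semS contrS (h / (n.+1 * m.+1)%:R) n.+1 m.+1 x.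
  have -> : m.+1%:R * (h / (n.+1 * m.+1)%:R) = h / n.+1%:R.
    rewrite natrM invfM mulrCA; congr (_ * _).
    by rewrite mulrCA mulfV ?mulr1 ?pnatr_eq0.
  move=> /(_ _ isT isT) H; apply: (le_trans (H _)); first by rewrite divr_ge0// ltW.
  apply: orbit_average_dist => // k km; apply: xK.
    by rewrite mulr_ge0// divr_ge0// ltW.
  rewrite natrM invfM mulrCA [k%:R * (_ * _)]mulrCA mulrA -[leRHS]mulr1 ler_wpM2l//.
  by rewrite ler_pdivrMr ?ltr0n// mul1r ler_nat ltnW.
have small (k : R) : 0 < k -> \forall n \near \oo, h / n.+1%:R < k.
  move=> k0; have kh0 : 0 < k / h by rewrite divr_gt0.
  near=> n; rewrite mulrC -ltr_pdivlMr//.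
  by near: n; exact: (near_infty_natSinv_lt (PosNum kh0)).
have /cvg_ex[w Ww] : cvg (W @ \oo).
  apply: cauchy_cvg; apply: cauchy_exP => k k0.
  have k30 : 0 < k / 3 by rewrite divr_gt0.
  have [r r0 rP] := semigroup_right_continuous0 semS x k30.
  have [n0 _ n0P] := small _ r0; exists (W n0), n0 => // n /= n0n.
  rewrite -ball_normE /=.
  (* Both averages are compared with that of their common refinement. *)
  have d1 : `|orbit_average S (h / (n0.+1 * n.+1)%:R) (n0.+1 * n.+1) x - W n0| <= k / 3.
    apply: W_mul => t t0 tn; apply: rP => //.
    by rewrite (le_trans tn)// ltW// n0P//=.
  have d2 : `|orbit_average S (h / (n0.+1 * n.+1)%:R) (n0.+1 * n.+1) x - W n| <= k / 3.
    rewrite [(_ * _)%N]mulnC; apply: W_mul => t t0 tn; apply: rP => //.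
    by rewrite (le_trans tn)// ltW// n0P//=.
  rewrite -[X in `|X|](subrKA (orbit_average S (h / (n0.+1 * n.+1)%:R) (n0.+1 * n.+1) x)).
  by rewrite (le_lt_trans (ler_normD _ _))// distrC; lra.
exists w, (h^-1 *: (S h x - x)); split.
  apply: generator_limit => // k k0.
  move/cvgrPdist_le : Ww => /(_ _ k0) Ww.
  have [n [wn hn]] : exists n, `|w - W n| <= k /\ h / n.+1%:R < k.
    near \oo => n; exists n; split; near: n => //; exact: small.
  exists (h / n.+1%:R), (W n); split => //; first by rewrite divr_gt0.
  - exact: ltW.
  - by rewrite distrC.
  rewrite (orbit_average_step semS)// scalerA mulrAC mulfV ?gt_eqF// mul1r.
  rewrite [n.+1%:R * _]mulrC divfK ?pnatr_eq0// subrr normr0 mulr_ge0//.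
  exact: ltW.
apply/ler_addgt0Pr => k k0.
move/cvgrPdist_le : Ww => /(_ _ k0)[n _ /(_ n (leqnn n)) Ww].
rewrite -(subrKA (W n)) (le_trans (ler_normD _ _))// lerD//; last by rewrite distrC.
rewrite distrC; apply: orbit_average_dist => // j jn.
apply: hP; first by rewrite mulr_ge0.
by rewrite mulrCA -[leRHS]mulr1 ler_wpM2l ?(ltW h0)// ler_pdivrMr ?ltr0n// mul1r ler_nat ltnW.
Unshelve. all: by end_near.
Qed.

(** * The domain as a subspace, and the modulus of continuity of orbits *)

Section semigroup_complements.
Context {R : realType} {X : normedModType R}.
Variable S : R -> X -> X.
Hypothesis semS : strongly_continuous_semigroup S.
Implicit Types (x y z : X).

Lemma generator_linear_subspace : linear_subspace (domain (generator S)).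
Proof.
split.
  exists 0; apply/cvg_quotient0P => e e0; exists 1 => // t t0 _ /=.
  rewrite -[X in S t X](scale0r (0 : X)) (semigroupZ semS) ?(ltW t0)// !(scale0r, scaler0).
  by rewrite !subr0 normr0 mulr_ge0// ltW.
move=> k x x' [y /cvg_quotient0P gy] [y' /cvg_quotient0P gy'].
exists (k *: y + y'); apply/cvg_quotient0P => e e0 /=.
have k1 : 0 < `|k| + 1 by rewrite ltr_wpDl.
have e1 : 0 < e / (`|k| + 1) by rewrite divr_gt0.
have [r r0 rP] := gy _ e1; have [r' r'0 rP'] := gy' _ e1.
exists (Num.min r r'); first by rewrite lt_min r0.
move=> t t0; rewrite le_min => /andP[/(rP _ t0) /= h /(rP' _ t0) /= h'].
rewrite (semigroupD semS) ?(ltW t0)// (semigroupZ semS) ?(ltW t0)//.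
rewrite [X in `|X|](_ : _ = k *: (S t x - x - t *: y) + (S t x' - x' - t *: y')).
  rewrite (le_trans (ler_normD _ _))// normrZ.
  rewrite [leRHS](_ : _ = `|k| * (e / (`|k| + 1) * t) + e / (`|k| + 1) * t).
    by rewrite lerD// ler_wpM2l.
  by field; rewrite gt_eqF.
rewrite !scalerBr scalerDr !scalerA (mulrC t k) !opprD !addrA.
rewrite -!addrA; congr (_ + _).
rewrite addrCA; congr (_ + _); rewrite [RHS]addrCA; congr (_ + _).
by rewrite addrCA.
Qed.

(** The operator at the smaller time factors out and is a contraction. *)
Lemma semigroup_modulus (contrS : forall (t : R) x, 0 <= t -> `|S t x| <= `|x|)
    (s t : R) x : 0 <= s -> 0 <= t ->
  `|S t x - S s x| <= `|S `|t - s| x - x|.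
Proof.
have [_ _ SD _] := semS.
wlog st : s t / s <= t => [H|] s0 t0.
  have [st|/ltW ts] := leP s t; first exact: H.
  by rewrite distrC (distrC t); exact: H.
have ts : 0 <= t - s by rewrite subr_ge0.
rewrite ger0_norm//.
have -> : S t x = S s (S (t - s) x) by rewrite -SD// addrC subrK.
by rewrite -(semigroupB semS)// contrS.
Qed.

End semigroup_complements.

(** * Convergence of products from consistency and stability *)

Section chernoff.
Context {R : realType} {X : normedModType R}.
Variables F S : R -> X -> X.
Hypothesis semS : strongly_continuous_semigroup S.
Hypothesis F0 : forall x, F 0 x = x.
Hypothesis FB : forall (t : R) x y, 0 <= t -> F t (x - y) = F t x - F t y.
Hypothesis contrF : forall (t : R) x, 0 <= t -> `|F t x| <= `|x|.

(** Consistency in the sense of Lax: the one-step error is [o(h)], uniformly along the orbit because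
    telescoping evaluates it at each [S (k%:R * h) x]. *)
Definition consistent x := forall tau e : R, 0 <= tau -> 0 < e ->
  exists2 dt : R, 0 < dt & forall h s : R, 0 < h -> h <= dt -> 0 <= s <= tau ->
    `|F h (S s x) - S h (S s x)| <= e * h.

Hypothesis consistent_dense : forall x (e : R), 0 < e ->
  exists2 y, consistent y & `|x - y| <= e.

Lemma iter_contr n (h : R) x : 0 <= h -> `|iter n (F h) x| <= `|x|.
Proof.
by move=> h0; elim: n => //= n; apply: le_trans; exact: contrF.
Qed.

Lemma iter_contrB n (h : R) x y : 0 <= h ->
  iter n (F h) (x - y) = iter n (F h) x - iter n (F h) y.
Proof. by move=> h0; elim: n => //= n ->; rewrite FB. Qed.

(** The contraction [F h] does not increase the error made so far, and each new step adds at most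
    [e * h]. *)
Lemma lax_estimate x (h tau e : R) n : 0 <= h ->
  (forall s : R, 0 <= s <= tau -> `|F h (S s x) - S h (S s x)| <= e * h) ->
  n%:R * h <= tau ->
  `|iter n (F h) x - S (n%:R * h) x| <= n%:R * (e * h).
Proof.
have [_ S0 SD _] := semS.
move=> h0 cons; elim: n => [_|n IH ntau].
  by rewrite /= !mul0r S0 subrr normr0.
have nh0 : 0 <= n%:R * h by rewrite mulr_ge0.
have ntau' : n%:R * h <= tau by apply: le_trans ntau; rewrite ler_wpM2r// ler_nat.
rewrite -natr1 !mulrDl !mul1r [_ + h]addrC SD//= -(subrKA (F h (S (n%:R * h) x))).
rewrite (le_trans (ler_normD _ _))// lerD//; last by apply: cons; rewrite nh0.
by rewrite -FB// (le_trans (contrF _ _))// IH.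
Qed.

Lemma consistent_cvg x (tau e : R) : consistent x -> 0 <= tau -> 0 < e ->
  \forall n \near \oo, forall t : R, 0 <= t <= tau ->
    `|iter n (F (t / n%:R)) x - S t x| <= e.
Proof.
have [_ S0 _ _] := semS.
move=> cx tau0 e0.
have tau1 : 0 < tau + 1 by lra.
(* The accumulated error is at most [t] times this tolerance; [tau + 1] in place of [tau] covers
   [tau = 0]. *)
have [dt dt0 dtP] := cx tau (e / (tau + 1)) tau0 (divr_gt0 e0 tau1).
have bnd := archi_boundP (divr_ge0 tau0 (ltW dt0)).
(* The successor makes [n] positive, and the bound itself makes [t / n%:R] at most [dt]. *)
exists (Num.Def.archi_bound (tau / dt)).+1 => // n /= Nn t /andP[t0 tt].
have n0 : 0 < n%:R :> R by rewrite ltr0n (leq_ltn_trans _ Nn).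
(* Consistency concerns positive steps only, so time zero is treated apart. *)
move: t0; rewrite le_eqVlt => /orP[/eqP <-|t0].
  rewrite mul0r S0 (_ : iter n _ x = x) ?subrr ?normr0 ?(ltW e0)//.
  by elim: n {Nn n0} => //= n ->.
have h0 : 0 < t / n%:R by rewrite divr_gt0.
have hdt : t / n%:R <= dt.
  rewrite ler_pdivrMr// (le_trans tt)// mulrC -ler_pdivrMr//.
  by rewrite (le_trans (ltW bnd))// ler_nat ltnW.
have nh : n%:R * (t / n%:R) = t by rewrite mulrC divfK// gt_eqF.
have := @lax_estimate x (t / n%:R) tau (e / (tau + 1)) n (ltW h0).
rewrite nh => /(_ _ tt) H; apply: (le_trans (H _)) => [s st|].
  by apply: dtP.
rewrite mulrCA nh mulrAC ler_pdivrMr// ler_wpM2l ?(ltW e0)//; lra.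
Qed.

(** On consistent vectors [S t] is a limit of contractions; density and the boundedness of [S t],
    with whatever constant [M], extend the bound to all vectors. *)
Lemma limit_contr (t : R) x : 0 <= t -> `|S t x| <= `|x|.
Proof.
move=> t0.
have cons y : consistent y -> `|S t y| <= `|y|.
  move=> cy; apply/ler_addgt0Pr => e e0.
  have [n _ /(_ n (leqnn n) t)] := consistent_cvg cy t0 e0.
  rewrite t0 lexx => /(_ isT) H.
  rewrite -[S t y](subrK (iter n (F (t / n%:R)) y)) (le_trans (ler_normD _ _))//.
  by rewrite addrC lerD 1?distrC// iter_contr// divr_ge0.
have [_ [M MP]] : bounded_linear (S t) by case: semS => + _ _ _; apply.
apply/ler_addgt0Pr => e e0.
have M1 : 0 < `|M| + 1 by rewrite ltr_wpDl.
have [y cy xy] := consistent_dense x (divr_gt0 e0 (addr_gt0 M1 ltr01)).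
rewrite -[S t x](subrK (S t y)) -(semigroupB semS)//.
rewrite (le_trans (ler_normD _ _))//.
have h1 : `|S t (x - y)| <= `|M| * `|x - y|.
  by rewrite (le_trans (MP _))// ler_wpM2r// ler_norm.
have := cons _ cy.
have := normr_ge0 (x - y).
have := ler_normD x (y - x); rewrite addrC subrK (distrC y).
move: xy; rewrite ler_pdivlMr; last by lra.
move: h1; set N := `|x - y|; set MM := `|M|; set u := `|S _ _|; lra.
Qed.

(** Both families are contractive, so replacing [x] by a consistent vector changes each side by at
    most [e / 4], uniformly in [n] and [t]. *)
Lemma chernoff_cvg x (tau e : R) : 0 <= tau -> 0 < e ->
  \forall n \near \oo, forall t : R, 0 <= t <= tau ->
    `|iter n (F (t / n%:R)) x - S t x| < e.
Proof.
move=> tau0 e0; have e40 : 0 < e / 4 by rewrite divr_gt0.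
have [y cy xy] := consistent_dense x e40.
apply: filterS (consistent_cvg cy tau0 e40) => n nP t /[dup] /nP nt /andP[t0 _].
have tn0 : 0 <= t / n%:R by rewrite divr_ge0.
rewrite -[X in `|X|](subrKA (iter n (F (t / n%:R)) y)) -iter_contrB//.
rewrite (le_lt_trans (ler_normD _ _))//.
have -> : iter n (F (t / n%:R)) y - S t x =
    (iter n (F (t / n%:R)) y - S t y) - S t (x - y).
  by rewrite (semigroupB semS)// opprB addrA subrK.
have := ler_normB (iter n (F (t / n%:R)) y - S t y) (S t (x - y)).
have := limit_contr (x - y) t0.
have := iter_contr n (x - y) tn0.
lra.
Qed.

End chernoff.

(** * The time-changed family and its derivative at zero *)

Section time_change.
Context {R : realType} {d : nat}.
Variables (T : R -> C0 R d -> C0 R d) (c : R) (a : 'rV[R]_d -> R).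
Hypothesis semT : strongly_continuous_semigroup T.
Hypothesis contrT : forall (t : R) x, 0 <= t -> `|T t x| <= `|x|.
Hypothesis c_gt0 : 0 < c.
Hypothesis a_continuous : continuous a.
Hypothesis a_bounds : forall q, c <= a q <= c^-1.
Implicit Types (x y g : C0 R d) (q : 'rV[R]_d).

Let a_gt0 q : 0 < a q.
Proof. by have /andP[+ _] := a_bounds q; apply: lt_le_trans. Qed.

Let a_ge0 q : 0 <= a q. Proof. exact: ltW. Qed.

Let a_le q : a q <= c^-1.
Proof. by have /andP[] := a_bounds q. Qed.

(** Continuity combines the norm continuity of the orbit with that of each [T s x]. For decay, the
    times [a q * |t|] lie in a compact segment, over which the functions [T s x] vanish at infinity
    uniformly. *)
Lemma time_change_C0 (t : R) x :
  (fun q => T (a q * `|t|) x q) \in C0_pred.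
Proof.
have [_ _ _ /(_ x)/continuous_half_lineP cT] := semT.
apply/asboolP; split.
  move=> q0; apply/(@cvgrPdist_lt _ _ _ (nbhs q0)) => e e0.
  have e20 : 0 < e / 2 by rewrite divr_gt0.
  have s0 : 0 <= a q0 * `|t| by rewrite mulr_ge0.
  have [r r0 rP] := cT _ _ s0 e20.
  have ca : (fun q => a q * `|t|) @ q0 --> a q0 * `|t|.
    exact: (@cvgM _ _ (nbhs q0) _ a (fun=> `|t|) _ _ (@a_continuous q0) (cvg_cst _)).
  have /(@cvgrPdist_lt _ _ _ (nbhs q0))/(_ _ e20) cTx :=
    @C0_continuous _ _ (T (a q0 * `|t|) x) q0.
  move/(@cvgrPdist_lt _ _ _ (nbhs q0))/(_ _ r0) in ca.
  near=> q.
  have /rP : `|a q * `|t| - a q0 * `|t| | < r by rewrite distrC; near: q.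
  rewrite mulr_ge0// => /(_ isT) h1.
  have := C0_norm_ge (T (a q * `|t|) x - T (a q0 * `|t|) x) q.
  rewrite -C0_normE C0B => h2.
  have h3 : `|T (a q0 * `|t|) x q0 - T (a q0 * `|t|) x q| < e / 2 by near: q.
  rewrite -(subrKA (T (a q0 * `|t|) x q)) (le_lt_trans (ler_normD _ _))//.
  by rewrite (distrC _ (T (a q * `|t|) x q)); lra.
move=> e e0; have e20 : 0 < e / 2 by rewrite divr_gt0.
(* A radius valid for [T s x] serves all nearby times because the orbit moves little in norm;
   compactness gives a common radius. *)
have /compact_near_coveringP/near_covering_withinP := @segment_compact R 0 (c^-1 * `|t|).
move=> /(_ R (pinfty_nbhs R)
  (fun M s => forall q, M < `|q| -> `|T s x q| < e))[].
  move=> s; rewrite /= in_itv /= => /andP[s0 _].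
  have [r r0 rP] := cT _ _ s0 e20.
  have [M MP] := C0_vanishing (T s x) e20.
  near=> s' M' => /= s'I q M'q.
  have s'0 : 0 <= s' by move: s'I; rewrite /= in_itv /= => /andP[].
  have /MP h1 : M < `|q|.
    by apply: (lt_trans _ M'q); near: M'; exact: nbhs_pinfty_gt (num_real M).
  have /(rP _ s'0) h2 : `|s' - s| < r by near: s'; exact: cvgr_distC_lt.
  have := C0_norm_ge (T s' x - T s x) q; rewrite -C0_normE C0B => h3.
  by rewrite -[T s' x q](subrK (T s x q)) (le_lt_trans (ler_normD _ _))//; lra.
move=> M [_ MP]; exists (M + 1) => q Mq.
apply: (MP (M + 1)) => //=; first by rewrite ltrDl.
by rewrite in_itv /= mulr_ge0//= ler_wpM2r.
Unshelve. all: by end_near.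
Qed.

Lemma multiply_C0 g : (fun q => a q * g q) \in C0_pred.
Proof.
apply/asboolP; split=> [q|e e0].
  exact: (@cvgM _ _ (nbhs q) _ a g _ _ (@a_continuous q) (@C0_continuous _ _ g q)).
have [M MP] := C0_vanishing g (mulr_gt0 e0 c_gt0); exists M => q /MP gq.
rewrite normrM (gtr0_norm (a_gt0 q)).
apply: le_lt_trans (_ : c^-1 * `|g q| < e); first by rewrite ler_wpM2r.
by rewrite ltr_pdivrMl// mulrC.
Qed.

(* The absolute value makes the family total; only t >= 0 matters. *)
Definition time_change (t : R) x : C0 R d := MkC0 (time_change_C0 t x).

Lemma time_changeE (t : R) x q : 0 <= t -> time_change t x q = T (a q * t) x q.
Proof. by move=> t0; rewrite /= ger0_norm. Qed.

Lemma time_change0 x : time_change 0 x = x.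
Proof.
have [_ T0 _ _] := semT.
by apply: C0E => q; rewrite time_changeE// mulr0 T0.
Qed.

Lemma time_change_linear (t : R) : 0 <= t -> linear (time_change t).
Proof.
move=> t0 k x y; apply: C0E => q; rewrite C0D C0Z !time_changeE//.
have [bl _ _ _] := semT; have [lT _] := bl (a q * t) (mulr_ge0 (a_ge0 q) t0).
by rewrite lT C0D C0Z.
Qed.

Lemma time_changeB (t : R) x y : 0 <= t ->
  time_change t (x - y) = time_change t x - time_change t y.
Proof.
move=> /time_change_linear lF.
by rewrite [x - y]addrC -scaleN1r lF scaleN1r addrC.
Qed.

Lemma time_change_contr (t : R) x : 0 <= t -> `|time_change t x| <= `|x|.
Proof.
move=> t0; apply: C0_norm_le => q; rewrite time_changeE//.
by rewrite (le_trans (C0_norm_ge _ _))// -C0_normE contrT// mulr_ge0.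
Qed.

Lemma time_change_strongly_continuous : strongly_continuous time_change.
Proof.
move=> x; apply/continuous_half_lineP => s e s0 e0.
have e20 : 0 < e / 2 by rewrite divr_gt0.
have [r r0 rP] := semigroup_right_continuous0 semT x e20.
(* Since [a] is at most [c^-1], times within [r * c] become times within [r], at every [q]. *)
exists (r * c); first by rewrite mulr_gt0.
move=> t t0; rewrite -ltr_pdivrMr// => tsr.
suff : `|time_change t x - time_change s x| <= e / 2 by lra.
apply: C0_norm_le => q; rewrite C0B !time_changeE// -C0B.
rewrite (le_trans (C0_norm_ge _ _))// -C0_normE.
rewrite (le_trans (semigroup_modulus semT contrT _ _ _)) ?mulr_ge0//.
apply: rP => //; rewrite -mulrBr normrM (ger0_norm (a_ge0 q)).
by rewrite (le_trans _ (ltW tsr))// mulrC ler_wpM2l.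
Qed.

(** At a fixed [q] this is the generator estimate for [T] at time [a q * h]; the upper bound on [a]
    makes it uniform in [q]. *)
Lemma time_change_estimate x g y (K h : R) : 0 <= h -> 0 <= K ->
  generator T (x, g) -> (forall q, y q = a q * g q) ->
  (forall r : R, 0 <= r <= h / c -> `|T r g - g| <= K) ->
  `|time_change h x - x - h *: y| <= K / c * h.
Proof.
move=> h0 K0 gxg yE gK; apply: C0_norm_le => q.
have ah0 : 0 <= a q * h by rewrite mulr_ge0.
have ahc : a q * h <= h / c by rewrite mulrC ler_wpM2l.
rewrite !C0B C0Z time_changeE// yE mulrA [h * a q]mulrC -C0Z -!C0B.
rewrite (le_trans (C0_norm_ge _ _))// -C0_normE.
rewrite (le_trans (@generator_estimate _ _ _ semT x g g K _ ah0 gxg _))//.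
  by move=> r /andP[r0 rh]; apply: gK; rewrite r0 (le_trans rh).
by rewrite -[leRHS]mulrA ler_wpM2l// ler_wpM2r.
Qed.

Lemma time_change_derivative x g y :
  generator T (x, g) -> (forall q, y q = a q * g q) ->
  derivative_at0 time_change (x, y).
Proof.
move=> gxg yE; apply/cvg_quotient0P => /= e e0.
(* The factor [c] offsets the division by [c] in [time_change_estimate]. *)
have [r r0 rP] := semigroup_right_continuous0 semT g (mulr_gt0 e0 c_gt0).
exists (r * c); first by rewrite mulr_gt0.
move=> t t0 tr; rewrite time_change0.
rewrite (le_trans (@time_change_estimate x g y (e * c) t _ _ gxg yE _)) ?(ltW t0)//.
- by rewrite mulr_ge0 ?ltW.
- move=> u /andP[u0 ut]; apply: rP => //; rewrite (le_trans ut)//.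
  by rewrite ler_pdivrMr.
- by rewrite mulfK// gt_eqF.
Qed.

(** * Consistency with the multiplicatively perturbed semigroup *)

Section multiplicative_perturbation.
Variable S : R -> C0 R d -> C0 R d.
Hypothesis semS : strongly_continuous_semigroup S.
Hypothesis generatorS : generator S = multiply_operator a (generator T).

(** Both operators move [S s x] by [h *: S s z] up to [o(h)]. These errors are uniform for [s] near
    a fixed [s0], and compactness makes them uniform on [[0, tau]]. *)
Lemma time_change_consistent x z : generator S (x, z) -> consistent time_change S x.
Proof.
move=> gxz tau e tau0 e0.
have [_ _ SD /(_ z)/continuous_half_lineP cS] := semS.
have ci0 : 0 < c^-1 by rewrite invr_gt0.
(* The sum of the constants in [est1] and [est2]. *)
pose C := 2 + (2 * c^-1 + 1) * c^-1.
have C0 : 0 < C by rewrite addr_gt0// mulr_gt0// addr_gt0// mulr_gt0.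
pose e1 := e / C; have e10 : 0 < e1 by rewrite divr_gt0.
have e1C : e1 * C = e by rewrite divfK// gt_eqF.
have orbit s : 0 <= s -> exists2 g, generator T (S s x, g) &
    forall q, S s z q = a q * g q.
  move=> s0; have := generator_orbit semS s0 gxz.
  by rewrite generatorS => -[g gT gE]; exists g.
have /compact_near_coveringP/near_covering_withinP := @segment_compact R 0 tau.
move=> /(_ R (0^'+)
  (fun h s => `|time_change h (S s x) - S h (S s x)| <= e * h))[].
  move=> s0; rewrite /= in_itv /= => /andP[s00 _].
  have [g0 g0T g0E] := orbit _ s00.
  have [r1 r10 r1P] := cS _ _ s00 e10.
  have [r2 r20 r2P] := semigroup_right_continuous0 semT g0 e10.
  have r1h : 0 < r1 / 2 by rewrite divr_gt0.
  have r2c : 0 < r2 * c by rewrite mulr_gt0.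
  near=> s h => /= sI.
  have s_ge0 : 0 <= s by move: sI; rewrite /= in_itv /= => /andP[].
  have h0 : 0 < h by near: h; exact: nbhs_right_gt.
  have hr1 : h < r1 / 2 by near: h; exact: nbhs_right_lt.
  have hr2 : h < r2 * c by near: h; exact: nbhs_right_lt.
  have ss0 : `|s - s0| < r1 / 2 by near: s; exact: cvgr_distC_lt.
  have vs : `|S s z - S s0 z| < e1 by apply: r1P => //; lra.
  have [g gT gE] := orbit _ s_ge0.
  (* As [a] is at least [c], dividing [S s z - S s0 z] by it keeps the difference small. *)
  have gg0 : `|g - g0| <= c^-1 * e1.
    apply: C0_norm_le => q; rewrite C0B.
    have := C0_norm_ge (S s z - S s0 z) q; rewrite -C0_normE C0B gE g0E.
    rewrite -mulrBr normrM (gtr0_norm (a_gt0 q)) => H.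
    rewrite ler_pdivlMl//; apply: (le_trans _ (ltW vs)); apply: le_trans H.
    by rewrite ler_wpM2r//; have /andP[] := a_bounds q.
  have est1 : `|S h (S s x) - S s x - h *: S s z| <= (2 * e1) * h.
    apply: (generator_estimate semS (ltW h0) (generator_orbit semS s_ge0 gxz)).
    move=> r /andP[r0 rh]; rewrite -SD//.
    have : `|S (r + s) z - S s0 z| < e1.
      apply: r1P; first by rewrite addr_ge0.
      rewrite -addrA (le_lt_trans (ler_normD _ _))// ger0_norm//; lra.
    move=> H; rewrite -(subrKA (S s0 z)) (le_trans (ler_normD _ _))//.
    by rewrite (distrC (S s0 z)); lra.
  have est2 : `|time_change h (S s x) - S s x - h *: S s z| <=
      ((2 * c^-1 + 1) * e1) / c * h.
    apply: (time_change_estimate (ltW h0) _ gT) => //.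
      by rewrite mulr_ge0 ?(ltW e10)// addr_ge0// mulr_ge0// ltW.
    move=> r /andP[r0 rh].
    have /r2P : r <= r2 by rewrite (le_trans rh)// ler_pdivrMr// ltW.
    move=> /(_ r0) H.
    (* The radius [r2] was chosen for the fixed [g0]; contractivity of [T] transfers the estimate to
       [g]. *)
    have -> : T r g - g = T r (g - g0) + (T r g0 - g0) - (g - g0).
      by rewrite (semigroupB semT)// opprB !addrA !subrK.
    rewrite (le_trans (ler_normB _ _))//.
    have := ler_normD (T r (g - g0)) (T r g0 - g0).
    have := contrT (g - g0) r0.
    lra.
  rewrite [X in `|X|](_ : _ = (time_change h (S s x) - S s x - h *: S s z) -
    (S h (S s x) - S s x - h *: S s z)).
    rewrite (le_trans (ler_normB _ _))// -e1C /C.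
    lra.
  by rewrite -![_ - S s x - _]addrA opprD addrACA subrr addr0.
move=> r /= r0 rP; exists (r / 2); first by rewrite divr_gt0.
move=> h s h0 hr sI; apply: (rP h) => //=.
by rewrite sub0r normrN gtr0_norm//; lra.
Unshelve. all: by end_near.
Qed.

(** Multiplication by [a] preserves the domain, so the dense domain of the generator of [T] consists
    of consistent vectors. *)
Lemma time_change_consistent_dense x (e : R) : 0 < e ->
  exists2 y, consistent time_change S y & `|x - y| <= e.
Proof.
move=> /(generator_dense semT contrT x)[w [g [gT xw]]]; exists w => //.
have [z gz] : exists z, generator S (w, z).
  by exists (MkC0 (multiply_C0 g)); rewrite generatorS; exists g.
exact: time_change_consistent gz.
Qed.

End multiplicative_perturbation.
End time_change.

(** * Chernoff equivalence and the Feynman formula *)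

Theorem theorem4p1 (R : realType) (d : nat)
  (H : 'rV[R]_d -> 'rV[R]_d -> R[i])
  (T : R -> C0 R d -> C0 R d)
  (p : R -> R.-spker 'rV[R]_d ~> 'rV[R]_d)
  (c : R) (a : 'rV[R]_d -> R)
  (Ttilde : R -> C0 R d -> C0 R d)
  (T_feller : feller_semigroup T)
  (T_generator : neg_pdo_generates H T)
  (T_transition : forall (t : R) (phi : C0 R d) (q : 'rV[R]_d), 0 <= t ->
     T t phi q = \int[p t q]_y phi y)
  (c_gt0 : 0 < c)
  (a_continuous : continuous a)
  (a_bounds : forall q, c <= a q <= c^-1)
  (Ttilde_semigroup : strongly_continuous_semigroup Ttilde)
  (Ttilde_generator : generator Ttilde = multiply_operator a (generator T)) :
  exists Ftilde : R -> C0 R d -> C0 R d,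
    [/\ forall (t : R) (phi : C0 R d) (q : 'rV[R]_d), 0 <= t ->
          Ftilde t phi q = T (a q * t) phi q /\
          Ftilde t phi q = \int[p (a q * t) q]_y phi y,
        chernoff_equivalent Ftilde Ttilde,
        forall (phi : C0 R d) (tau e : R), 0 <= tau -> 0 < e ->
          \forall n \near \oo, forall t : R, 0 <= t <= tau ->
            `|iter n (Ftilde (t / n%:R)) phi - Ttilde t phi| < e &
        forall (phi : C0 R d) (tau e : R), 0 <= tau -> 0 < e ->
          \forall n \near \oo, forall t : R, 0 <= t <= tau ->
            forall q0 : 'rV[R]_d,
            `|feynman_integral p a (t / n%:R) phi n q0 - Ttilde t phi q0| < e].
Proof.
have [semT _ contrT] := T_feller.
have {}contrT (t : R) x : 0 <= t -> `|T t x| <= `|x| by exact: contrT.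
pose F := time_change semT c_gt0 a_continuous a_bounds.
have FE (t : R) x q : 0 <= t -> F t x q = T (a q * t) x q by exact: time_changeE.
have a_ge0 q : 0 <= a q.
  by have /andP[/(lt_le_trans c_gt0)/ltW] := a_bounds q.
have F0 x : F 0 x = x by exact: time_change0.
have FB (t : R) x y : 0 <= t -> F t (x - y) = F t x - F t y.
  exact: time_changeB.
have contrF (t : R) x : 0 <= t -> `|F t x| <= `|x| by exact: time_change_contr.
have dense x (e : R) : 0 < e -> exists2 y, consistent F Ttilde y & `|x - y| <= e.
  exact: time_change_consistent_dense.
have contrS (t : R) x : 0 <= t -> `|Ttilde t x| <= `|x|.
  exact: (limit_contr Ttilde_semigroup F0 FB contrF dense).
have chern := chernoff_cvg Ttilde_semigroup F0 FB contrF dense.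
(* Integrating against one kernel is one application of [F s], by the transition formula at time
   [a q * s]. *)
have feynmanE n (s : R) (x : C0 R d) q : 0 <= s -> feynman_integral p a s x n q = iter n (F s) x q.
  move=> s0; elim: n q => // n IH q.
  rewrite iterS FE// T_transition ?mulr_ge0//.
  by apply: eq_Rintegral => y _; exact: IH.
exists F; split.
- by move=> t x q t0; rewrite -T_transition ?mulr_ge0// FE.
- split.
  + move=> t t0; split; first exact: time_change_linear.
    by exists 1 => x; rewrite mul1r contrF.
  + exact: time_change_strongly_continuous.
  + exact: F0.
  + by exists 0 => // t t0 x; rewrite mul0r expR0 mul1r contrF.
  (* On this subspace the derivative at zero is already the full generator, so closability and the
     closure statement reduce to [generator_closed]. *)
  have restrE : restriction (derivative_at0 F) (domain (generator T)) =
      generator Ttilde.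
    rewrite Ttilde_generator; apply/seteqP; split.
      move=> [x y] [Fxy [g gT]]; exists g => // q.
      have Fxg : derivative_at0 F (x, MkC0 (multiply_C0 c_gt0 a_continuous a_bounds g)).
        exact: (time_change_derivative semT c_gt0 a_continuous a_bounds gT).
      by have -> : y = MkC0 (multiply_C0 c_gt0 a_continuous a_bounds g)
        by exact: cvg_unique Fxy Fxg.
    move=> [x y] [g gT yE]; split; last by exists g.
    exact: (time_change_derivative semT c_gt0 a_continuous a_bounds gT).
  have clE := generator_closed Ttilde_semigroup contrS.
  exists (domain (generator T)); split.
  + exact: generator_linear_subspace.
  + move=> x [g gT]; exists (MkC0 (multiply_C0 c_gt0 a_continuous a_bounds g)).
    exact: (time_change_derivative semT c_gt0 a_continuous a_bounds gT).
  + rewrite restrE => x y z; rewrite clE => xy xz.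
    exact: cvg_unique xy xz.
  + by rewrite restrE.
- exact: chern.
- move=> x tau e tau0 e0; apply: filterS (chern x tau e tau0 e0) => n nP t tt q.
  have /andP[t0 _] := tt.
  rewrite feynmanE ?divr_ge0// -C0B (le_lt_trans (C0_norm_ge _ _))//.
  by rewrite -C0_normE nP.
Qed.
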